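(* Let $n,k$ be positive integers with $k\geqslant n$, let $m_1,\ldots,m_n$ be nonnegative integers and $M=m_1+\cdots+m_n$. Then $$\sum_{\substack{k_1+\cdots+k_n=k\\ k_j\geqslant 1}}k_1^{m_1}\cdots k_n^{m_n}\zeta(2k_1)\cdots\zeta(2k_n)=(-1)^n\sum_{l=0}^{\min\{T,k\}}\frac{(2l)!}{B_{2l}}\left(\sum_{j=1}^{M+n-2l}\frac{a_{jl}}{2^{M+n-j-1}}(k-l)^{j-1}\right)\zeta(2l)\zeta(2k-2l),$$ where $T=\max\{[(M+n-2)/2],[(n-1)/2]\}$ and $a_{jl}$ are the rational numbers defined in the context.
   Context: $\zeta$ is the Riemann zeta function, with $\zeta(0)=-\frac12$. $B_i$ are the Bernoulli numbers, $\sum_{i\geqslant0}\frac{B_i}{i!}t^i=\frac{t}{e^t-1}$; $[x]$ is the greatest integer not exceeding $x$. The polynomials $f_{mi}(t)\in\mathbb{Q}[t]$ ($m\geqslant 0$, $0\leqslant i\leqslant m+1$) are defined by $f_{00}(t)=\frac12 t-1$, $f_{01}(t)=1$ and, for $m\geqslant 1$: $f_{m0}(t)=tf_{m-1,0}'(t)$; $f_{m,m+1}(t)=-mf_{m-1,m}(t)$; $f_{mi}(t)=tf'_{m-1,i}(t)+i(1-t)f_{m-1,i}(t)-(i-1)f_{m-1,i-1}(t)$ for $1\leqslant i\leqslant m$. For $m\geqslant 0$ let $A_m(t)$ be the $(m+1)\times(m+1)$ lower triangular matrix with entry $f_{ri}(t)$ in row $r$ ($0\leqslant r\leqslant m$),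 column $i$ ($1\leqslant i\leqslant r+1$); it is invertible, and $g_{ri}(t)$ is the entry in row $r$, column $i$ of $A_m(t)^{-1}$ (independent of $m\geqslant r$). Set $f_i(t)=\sum_{i_1+\cdots+i_n=i,\ 0\leqslant i_j\leqslant m_j+1}f_{m_1i_1}(t)\cdots f_{m_ni_n}(t)$ and $F_j(t)=\sum_{i=j}^{M+n}f_i(t)g_{i-1,j}(t)$ for $1\leqslant j\leqslant M+n$; these are even polynomials, and $a_{jl}\in\mathbb{Q}$ denotes the coefficient of $t^{2l}$ in $F_j(t)$. *)

(* Defs.v *)
From HB Require Import structures.
From mathcomp Require Import all_boot all_order all_algebra.
From mathcomp Require Import all_classical all_reals all_analysis.
Set Implicit Arguments.
Unset Strict Implicit.
Unset Printing Implicit Defensive.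
Import Order.TTheory GRing.Theory Num.Theory.
Import numFieldNormedType.Exports.
Local Open Scope ring_scope.

(* Formal power series over rat are represented by their coefficient sequences. *)
Definition fps_mul (u v : nat -> rat) (n : nat) : rat :=
  \sum_(i < n.+1) u i * v (n - i)%N.

Fixpoint fps_inv_seq (u : nat -> rat) (n : nat) : seq rat :=
  if n is m.+1 then
    let s := fps_inv_seq u m in
    rcons s ((u 0%N)^-1 * ((m == 0%N)%:R - \sum_(i < m) s`_i * u (m - i)%N))
  else [::].

Definition fps_inv (u : nat -> rat) (n : nat) : rat := (fps_inv_seq u n.+1)`_n.

(* t / (e^t - 1) is the inverse of (e^t - 1) / t = \sum_n t^n / (n + 1)!;
   see bernoulli_gen for the generating function identity. *)
Definition bernoulli_num (i : nat) : rat :=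
  i`!%:R * fps_inv (fun n => (n.+1`!%:R)^-1) i.

Lemma size_fps_inv_seq u n : size (fps_inv_seq u n) = n.
Proof. by elim: n => //= n IHn; rewrite size_rcons IHn. Qed.

Lemma nth_fps_inv_seq u n i : (i < n)%N -> (fps_inv_seq u n)`_i = fps_inv u i.
Proof.
elim: n => // n IHn; rewrite ltnS leq_eqVlt => /orP[/eqP ->//|lt_in].
by rewrite /= nth_rcons size_fps_inv_seq lt_in IHn.
Qed.

Lemma fps_invP u : u 0%N != 0 ->
  forall n, fps_mul (fps_inv u) u n = (n == 0%N)%:R.
Proof.
move=> u0 n; rewrite /fps_mul big_ord_recr /= subnn.
rewrite {2}/fps_inv /= nth_rcons size_fps_inv_seq ltnn eqxx.
rewrite mulrAC mulVf // mul1r.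
rewrite [X in _ + (_ - X)](eq_bigr (fun i : 'I_n => fps_inv u i * u (n - i)%N)).
  by rewrite addrC subrK.
by move=> i _; rewrite nth_fps_inv_seq.
Qed.

(* (\sum_i B_i / i! t^i) (e^t - 1) = t, coefficientwise *)
Lemma bernoulli_gen n :
  fps_mul (fun i => bernoulli_num i / i`!%:R)
          (fun i => (i`!%:R)^-1 - (i == 0%N)%:R) n = (n == 1%N)%:R.
Proof.
case: n => [|n]; first by rewrite /fps_mul big_ord1 /= invr1 subrr mulr0.
rewrite /fps_mul big_ord_recr /= subnn invr1 subrr mulr0 addr0.
rewrite eqSS -(@fps_invP (fun n => (n.+1`!%:R)^-1)) ?invr1 ?oner_neq0 //.
apply: eq_bigr => i _; rewrite /bernoulli_num [X in X * _ = _]mulrAC divff ?mul1r.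
  by rewrite subSn 1?subr0 // -ltnS.
by rewrite pnatr_eq0 -lt0n fact_gt0.
Qed.

(* The series defining zeta converges only for s > 1, so s = 1 is a junk value;
   the value at 0 is that of the analytic continuation. *)
Definition zeta (R : realType) (s : nat) : R :=
  if s == 0%N then - 2^-1
  else limn (series (fun n : nat => (n.+1%:R ^+ s)^-1 : R)).

(* Zero for i > m + 1. *)
Fixpoint f_ (m i : nat) : {poly rat} :=
  match m with
  | 0 => if i == 0%N then 2^-1 *: 'X - 1 else if i == 1%N then 1 else 0
  | m'.+1 =>
      if i == 0%N then 'X * (f_ m' 0%N)^`()
      else if (i <= m)%N then
        'X * (f_ m' i)^`() + i%:R *: ((1 - 'X) * f_ m' i)
          - (i.-1)%:R *: f_ m' i.-1
      else if i == m.+1 then - (m%:R *: f_ m' m)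
      else 0
  end.

(* Columns are numbered from 1 in the text: column c : 'I_m.+1 holds f_{r,c+1}. *)
Definition Amx (m : nat) : 'M[{poly rat}]_m.+1 :=
  \matrix_(r, c) (if (c <= r)%N then f_ r c.+1 else 0).

(* Entry in row r (from 0) and column i (from 1) of A_m^-1; it does not depend
   on m, see g_indep. *)
Definition g_ (m r i : nat) : {poly rat} := invmx (Amx m) (inord r) (inord i.-1).

Lemma f_diag m : f_ m m.+1 = ((-1) ^+ m * m`!%:R)%:P.
Proof.
elim: m => [|m IHm]; first by rewrite /= mulr1.
have E : f_ m.+1 m.+2 = - (m.+1%:R *: f_ m m.+1) by rewrite /= ltnn eqxx.
rewrite {}E IHm -mul_polyC -polyCM -polyCN factS natrM exprS mulN1r mulNr.
by congr (_%:P); congr (- _); rewrite mulrCA.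
Qed.

Lemma Amx_unit m : Amx m \in unitmx.
Proof.
have tA : is_trig_mx (Amx m).
  by apply/is_trig_mxP => i j lt_ij; rewrite mxE leqNgt lt_ij.
rewrite unitmxE (det_trig tA); apply: rpred_prod => i _.
rewrite mxE leqnn f_diag poly_unitE size_polyC coefC /= unitfE.
rewrite mulf_eq0 signr_eq0 pnatr_eq0 /= -lt0n fact_gt0 /=.
by [].
Qed.

Lemma g_indep m r i : (r <= m)%N -> (0 < i <= r.+1)%N -> g_ m r i = g_ r r i.
Proof.
move=> le_rm; case: i => // i; move=> /= le_ir.
pose P : 'M[{poly rat}]_(r.+1, m.+1) := \matrix_(a, b) ((a == b :> nat)%:R).
have PA : P *m Amx m = Amx r *m P.
  apply/matrixP => a b; rewrite !mxE.
  have lt_am : (a < m.+1)%N by apply: leq_trans (ltn_ord a) _.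
  rewrite (bigD1 (Ordinal lt_am)) //= !mxE eqxx mul1r big1 ?addr0; last first.
    move=> c; rewrite -val_eqE /= eq_sym => /negPf ne_ac.
    by rewrite mxE ne_ac mul0r.
  have [lt_br|le_rb] := ltnP b r.+1.
    rewrite (bigD1 (Ordinal lt_br)) //= !mxE eqxx mulr1 big1 ?addr0 //.
    by move=> c; rewrite -val_eqE /= => /negPf ne; rewrite !mxE ne mulr0.
  rewrite leqNgt (leq_trans (ltn_ord a) le_rb) /= big1 // => c _.
  by rewrite !mxE (ltn_eqF (leq_trans (ltn_ord c) le_rb)) mulr0.
have : P *m invmx (Amx m) = invmx (Amx r) *m P.
  apply: (can_inj (mulKmx (Amx_unit r))).
  by rewrite mulmxA -PA mulKVmx ?Amx_unit // mulmxK ?Amx_unit.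
move/matrixP/(_ (inord r) (inord i)).
have lt_im : (i < m.+1)%N by apply: leq_trans le_ir _.
rewrite !mxE (bigD1 (inord r)) //= !mxE !inordK // eqxx mul1r big1 ?addr0.
  rewrite /g_ /= => ->; rewrite (bigD1 (inord i)) //= !mxE !inordK // eqxx mulr1 big1 ?addr0 //.
  move=> c; rewrite -val_eqE /= inordK // => /negPf ne.
  by rewrite !mxE inordK // ne mulr0.
move=> c; rewrite -val_eqE /= inordK // eq_sym => /negPf ne.
by rewrite !mxE inordK // ne mul0r.
Qed.

Definition fsum (n : nat) (m : 'I_n -> nat) (i : nat) : {poly rat} :=
  \sum_(c : {ffun 'I_n -> 'I_i.+1} |
          (\sum_(j < n) c j == i)%N && [forall j, (c j <= (m j).+1)%N])
     \prod_(j < n) f_ (m j) (c j).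

Definition F_ (n : nat) (m : 'I_n -> nat) (j : nat) : {poly rat} :=
  let N := (\sum_(i < n) m i + n)%N in
  \sum_(j <= i < N.+1) fsum m i * g_ N.-1 i.-1 j.

Definition a_ (n : nat) (m : 'I_n -> nat) (j l : nat) : rat := (F_ m j)`_(2 * l).

(* Main.v *)
(**
Put beta_i = B_i / i! and h = t / (e^t - 1) = \sum_i beta_i t^i.

Euler's formula is needed only up to the value of zeta(2), since both sides of
the theorem are homogeneous of weight 2k.  It follows by induction from
\sum_(0 < j < k) zeta(2j) zeta(2k - 2j) = (k + 1/2) zeta(2k), obtained by
truncating the series at N and summing 1 / (n^2 - m^2) over n <> m, and from the
analogous convolution for beta, which is the Riccati equation
t E' = E - E^2 + t^2 / 4 of E = h + t / 2.  This turns the theorem into an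
identity between the beta_{2k}.

On Q[t][H] let [der] be the derivation with der t = t and
der H = (1 - t) H - H^2, the equation satisfied by h.  The polynomials
P_m = \sum_i f_{mi} H^i are the iterated derivatives of P_0 = H + t / 2 - 1,
and inverting A_m gives P_{m_1} ... P_{m_n} = C + \sum_j F_j P_{j-1} with C in
Q[t].  Evaluating at H = h and comparing the coefficients of t^{2k} yields the
identity, provided the F_j are even and small enough:
- the substitution t -> -t, H -> H + t commutes with [der] and fixes P_0, so by
  uniqueness of the expansion the F_j and C are even;
- total degree in t and H gives deg F_j <= M + n - j;
- when M > 0, the vanishing odd coefficients of C kill the coefficient of
  t^{M+n-1} in F_1, which accounts for the bound T.
*)

Require Import Defs.
From HB Require Import structures.
From mathcomp Require Import all_boot all_order all_algebra.
From mathcomp Require Import all_classical all_reals all_analysis.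
From mathcomp Require Import ring lra zify.
Set Implicit Arguments.
Unset Strict Implicit.
Unset Printing Implicit Defensive.
Import Order.TTheory GRing.Theory Num.Theory.
Import numFieldNormedType.Exports.
Local Open Scope ring_scope.

(** * Partial sums of zeta *)

Definition zeta_partial (R : realType) (s N : nat) : R :=
  \sum_(i < N) (i.+1%:R ^+ s)^-1.

Definition harmonic_sum (R : realType) (N : nat) : R :=
  \sum_(i < N) (i.+1%:R)^-1.

Lemma zeta_partial_le2 (R : realType) s N :
  (2 <= s)%N -> zeta_partial R s N <= 2.
Proof.
move=> s2.
(* The sharper bound is inductive because 1/(N + 2)^2 <= 1/(N + 1) - 1/(N + 2). *)
suff H : zeta_partial R s N.+1 <= 2 - (N.+1%:R)^-1.
  apply: le_trans (_ : zeta_partial R s N.+1 <= _).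
    by rewrite /zeta_partial big_ord_recr /= lerDl invr_ge0 exprn_ge0.
  by apply: le_trans H _; rewrite gerBl invr_ge0.
elim: N => [|N IHN].
  by rewrite /zeta_partial big_ord1 expr1n invr1; lra.
rewrite /zeta_partial big_ord_recr /= -/(zeta_partial R s N.+1).
have N1 : 0 < N.+1%:R :> R by [].
have N2 : 0 < N.+2%:R :> R by [].
suff : (N.+2%:R ^+ s)^-1 <= (N.+1%:R)^-1 - (N.+2%:R)^-1 :> R.
  by move=> h; move: (lerD IHN h); rewrite subrKA.
apply: le_trans (_ : (N.+2%:R ^+ 2)^-1 <= _).
  by rewrite lef_pV2 ?posrE ?exprn_gt0 // ler_weXn2l // ler1n.
have -> : (N.+1%:R)^-1 - (N.+2%:R)^-1 = (N.+1%:R * N.+2%:R)^-1 :> R.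
  have E2 : N.+2%:R = N.+1%:R + 1 :> R by rewrite [LHS]mulrSr.
  by rewrite E2 in N2 *; field; rewrite !gt_eqF.
by rewrite lef_pV2 ?posrE ?exprn_gt0 ?mulr_gt0 // expr2 ler_pM2r // ler_nat.
Qed.

Lemma zeta_partial_cvg (R : realType) s : (2 <= s)%N ->
  (zeta_partial R s N @[N --> \oo] --> zeta R s)%classic.
Proof.
move=> s2; rewrite /zeta; case: eqP s2 => [->//|_ s2].
have E : zeta_partial R s = series (fun n : nat => (n.+1%:R ^+ s)^-1 : R).
  by apply/funext => N; rewrite /series /= big_mkord.
rewrite -E; apply/cvg_ex; exists (sup (range (zeta_partial R s))).
apply: nondecreasing_cvgn.
  apply/nondecreasing_seqP => N.
  by rewrite /zeta_partial [leRHS]big_ord_recr /= lerDl invr_ge0 exprn_ge0.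
by exists 2 => _ [N _ <-]; exact: zeta_partial_le2.
Qed.

Lemma zeta_gt0 (R : realType) s : (2 <= s)%N -> 0 < zeta R s.
Proof.
move=> s2; apply: lt_le_trans ltr01 _.
apply: (@cvgr_to_ge _ \oo%classic _ R (zeta_partial R s)).
  exact: zeta_partial_cvg.
near=> N.
have N0 : (0 < N)%N by near: N; exact: nbhs_infty_gt.
rewrite -(prednK N0) /zeta_partial big_ord_recl /= expr1n invr1 lerDl.
by apply: sumr_ge0 => i _; rewrite invr_ge0 exprn_ge0.
Unshelve. all: by end_near. Qed.

(** * Convolution of the even zeta values *)

(** Indices are shifted, m standing for the integer m + 1; the value 0 on the diagonal encodes the
    restriction n <> m. *)
Definition inv_sqr_diff (R : realType) (m n : nat) : R :=
  if m == n then 0 else (n.+1%:R ^+ 2 - m.+1%:R ^+ 2)^-1.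

Lemma inv_sqr_diff_anti (R : realType) m n :
  inv_sqr_diff R m n = - inv_sqr_diff R n m.
Proof.
rewrite /inv_sqr_diff eq_sym; case: eqP => _; first by rewrite oppr0.
by rewrite -invrN opprB.
Qed.

Lemma inv_sqr_diffE (R : realType) m n : m != n ->
  2 * m.+1%:R * inv_sqr_diff R m n =
  (n%:R - m%:R)^-1 - ((n + m).+2%:R)^-1.
Proof.
move=> mn; rewrite /inv_sqr_diff (negPf mn).
have nz : n%:R - m%:R != 0 :> R by rewrite subr_eq0 eqr_nat eq_sym.
have nz2 : n%:R + m%:R + 2 != 0 :> R by rewrite -natrD -natrD pnatr_eq0 addn2.
have -> : (n + m).+2%:R = n%:R + m%:R + 2 :> R by rewrite -addn2 !natrD.
have -> : n.+1%:R ^+ 2 - m.+1%:R ^+ 2 = (n%:R - m%:R) * (n%:R + m%:R + 2) :> R.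
  by rewrite -!natr1; ring.
by rewrite -natr1; field; apply/andP.
Qed.

(** Both partial fractions of [inv_sqr_diffE] telescope; as n < m, the differences n - m are
    negative, which reverses the first harmonic block. *)
Lemma sum_inv_sqr_diff_below (R : realType) m N : (N <= m)%N ->
  2 * m.+1%:R * (\sum_(n < N) inv_sqr_diff R m n) =
  harmonic_sum R (m - N) - harmonic_sum R m
  - harmonic_sum R (N + m).+1 + harmonic_sum R m.+1.
Proof.
elim: N => [|N IHN] Nm; first by rewrite big_ord0 subn0 add0n; ring.
rewrite big_ord_recr /= mulrDr IHN 1?ltnW // inv_sqr_diffE ?gtn_eqF //.
have -> : (m - N = (m - N.+1).+1)%N by lia.
rewrite [harmonic_sum R (m - N.+1).+1]big_ord_recr.
rewrite [harmonic_sum R (N.+1 + m).+1]big_ord_recr /=.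
rewrite -/(harmonic_sum _ _) -/(harmonic_sum _ (N + m).+1).
have -> : N%:R - m%:R = - (m - N.+1).+1%:R :> R.
  by rewrite -natr1 natrB // -natr1; ring.
by rewrite invrN; ring.
Qed.

(** Past the diagonal the telescoping continues from the case p = 0. What remains is a block of 2 (m
    + 1) harmonic terms, which vanishes as p grows, so the full series is 3/4 (m + 1)^-2. *)
Lemma sum_inv_sqr_diff (R : realType) m p :
  \sum_(n < m.+1 + p) inv_sqr_diff R m n =
  3 / 4 * (m.+1%:R ^+ 2)^-1
  - (harmonic_sum R (p + m.+1.*2) - harmonic_sum R p) / (2 * m.+1%:R).
Proof.
have m0 : m.+1%:R != 0 :> R by rewrite pnatr_eq0.
suff H : 2 * m.+1%:R * (\sum_(n < m.+1 + p) inv_sqr_diff R m n) =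
  3 / 2 * (m.+1%:R)^-1 - (harmonic_sum R (p + m.+1.*2) - harmonic_sum R p).
  apply: (mulfI (_ : 2 * m.+1%:R != 0)); first by rewrite mulf_neq0 ?pnatr_eq0.
  by rewrite H; field.
elim: p => [|p IHp].
  rewrite addn0 big_ord_recr /= {2}/inv_sqr_diff eqxx addr0.
  rewrite sum_inv_sqr_diff_below // subnn.
  have -> : harmonic_sum R 0 = 0 by exact: big_ord0.
  rewrite add0n doubleS -addnn [harmonic_sum R (m + m).+2]big_ord_recr.
  rewrite [harmonic_sum R m.+1]big_ord_recr /=.
  rewrite -/(harmonic_sum R m) -/(harmonic_sum R (m + m).+1).
  have -> : (m + m).+2%:R = 2 * m.+1%:R :> R.
    by rewrite -natrM; congr _%:R; lia.
  by field.
rewrite addnS big_ord_recr /= mulrDr IHp inv_sqr_diffE ?ltn_eqF //; last lia.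
rewrite addSn [harmonic_sum R p.+1]big_ord_recr.
rewrite [harmonic_sum R (p + _).+1]big_ord_recr /=.
rewrite -/(harmonic_sum R p) -/(harmonic_sum R (p + m.+1.*2)).
have -> : (m.+1 + p)%:R - m%:R = p.+1%:R :> R.
  by rewrite -natrB; [congr _%:R; lia|lia].
have -> : ((m.+1 + p + m).+2 = (p + m.+1.*2).+1)%N by lia.
by ring.
Qed.

Lemma harmonic_sum_bounds (R : realType) p q :
  0 <= harmonic_sum R (p + q) - harmonic_sum R p <= q%:R / p.+1%:R.
Proof.
elim: q => [|q /andP[IH1 IH2]]; first by rewrite addn0 subrr mul0r lexx.
rewrite addnS [harmonic_sum R (p + q).+1]big_ord_recr /=.
rewrite -/(harmonic_sum R (p + q)).
have h1 : 0 <= ((p + q).+1%:R)^-1 :> R by rewrite invr_ge0.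
have h2 : ((p + q).+1%:R)^-1 <= (p.+1%:R)^-1 :> R.
  by rewrite lef_pV2 ?posrE // ler_nat; lia.
by rewrite -[q.+1%:R]natr1 mulrDl mul1r addrAC addr_ge0 // lerD.
Qed.

(** The harmonic blocks of [sum_inv_sqr_diff] at N = (m + 1) + p, weighted by (m + 1)^-(2q + 2). *)
Definition conv_error (R : realType) (q N : nat) : R :=
  \sum_(m < N) (m.+1%:R ^+ (2 * q.+1))^-1 *
    ((harmonic_sum R (N - m.+1 + m.+1.*2) - harmonic_sum R (N - m.+1))
      / (2 * m.+1%:R)).

(** With x = m + 1 and y = N - m the harmonic block is at most 2x / y, so a term is at most 1 / (x^2
    y) = (1 / x^2 + 1 / (x y)) / (N + 1), and x y >= x + y - 1 = N. Summing over m gives at most (2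
    + 1) / (N + 1). *)
Lemma conv_error_bounds (R : realType) q N :
  0 <= conv_error R q N <= 3 / N.+1%:R.
Proof.
rewrite /conv_error; apply/andP; split.
  apply: sumr_ge0 => m _; rewrite mulr_ge0 ?invr_ge0 ?exprn_ge0 //.
  rewrite divr_ge0 ?mulr_ge0 //.
  by have /andP[] := harmonic_sum_bounds R (N - m.+1) m.+1.*2.
apply: le_trans (_ : \sum_(m < N) ((m.+1%:R ^+ 2)^-1 + (N%:R)^-1) / N.+1%:R <= _).
  apply: ler_sum => m _.
  set p := (N - m.+1)%N.
  have EN : N = (m.+1 + p)%N by have := ltn_ord m; lia.
  have /andP[h0 h1] := harmonic_sum_bounds R p m.+1.*2.
  set h := _ - _ in h0 h1 *.
  have x0 : 0 < m.+1%:R :> R by [].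
  have x1 : 1 <= m.+1%:R :> R by rewrite ler1n.
  have y0 : 0 < p.+1%:R :> R by [].
  have y1 : 1 <= p.+1%:R :> R by rewrite ler1n.
  set x : R := m.+1%:R in x0 x1 *; set y : R := p.+1%:R in y0 y1 *.
  have EN1 : N.+1%:R = x + y :> R by rewrite -natrD; congr _%:R; lia.
  have EN0 : N%:R = x + y - 1 :> R by rewrite -EN1 -natr1; ring.
  rewrite EN1 EN0.
  apply: le_trans (_ : (x ^+ 2)^-1 / y <= _).
    have x0' := ltW x0.
    apply: ler_pM; rewrite ?invr_ge0 ?exprn_ge0 ?divr_ge0 ?mulr_ge0 //.
      by rewrite lef_pV2 ?posrE ?exprn_gt0 // ler_weXn2l //; lia.
    rewrite ler_pdivrMr ?mulr_gt0 //; apply: le_trans h1 _.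
    by rewrite -muln2 natrM -/x [leLHS]mulrC [x * 2]mulrC.
  have -> : (x ^+ 2)^-1 / y = ((x ^+ 2)^-1 + (x * y)^-1) / (x + y).
    clearbody x y; have xy := addr_gt0 x0 y0.
    by field; rewrite !lt0r_neq0.
  rewrite ler_pM2r ?invr_gt0 ?addr_gt0 // lerD2l lef_pV2 ?posrE ?mulr_gt0 //.
    by nra.
  by lra.
rewrite -mulr_suml ler_pM2r ?invr_gt0 // big_split /= -/(zeta_partial R 2 N).
rewrite sumr_const card_ord -[_^-1 *+ N]mulr_natr.
have := zeta_partial_le2 R N (leqnn 2).
have [->|N0] := eqVneq N 0%N; first by rewrite mulr0; lra.
by rewrite mulVf ?pnatr_eq0 //; lra.
Qed.

(* Off the diagonal this is a geometric sum; its antisymmetry in m and n turns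
   the double sum into one over 1 / (n^2 - m^2), which telescopes. *)
Lemma sum_geometric_pair (R : realType) q m n :
  \sum_(j < q.+1) (m.+1%:R ^+ (2 * j.+1))^-1 * (n.+1%:R ^+ (2 * (q.+1 - j)))^-1
  = (m == n)%:R * (q.+1%:R * (m.+1%:R ^+ (2 * q.+2))^-1)
    + ((m.+1%:R ^+ (2 * q.+1))^-1 - (n.+1%:R ^+ (2 * q.+1))^-1)
      * inv_sqr_diff R m n :> R.
Proof.
rewrite /inv_sqr_diff; case: eqVneq => [<-|mn].
  rewrite mulr0 addr0 mul1r mulr_natl.
  transitivity (\sum_(j < q.+1) (m.+1%:R ^+ (2 * q.+2))^-1 : R); last first.
    by rewrite sumr_const card_ord.
  apply: eq_bigr => j _; rewrite -invfM -exprD; congr (_ ^+ _)^-1.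
  by have := ltn_ord j; lia.
rewrite mul0r add0r.
have xy : n.+1%:R ^+ 2 - m.+1%:R ^+ 2 != 0 :> R.
  by rewrite -!natrX subr_eq0 eqr_nat eqn_exp2r // eqSS eq_sym.
have x0 : m.+1%:R != 0 :> R by rewrite pnatr_eq0.
have y0 : n.+1%:R != 0 :> R by rewrite pnatr_eq0.
set x := m.+1%:R in x0 xy *; set y := n.+1%:R in y0 xy *.
apply: (mulIf xy); rewrite -mulrA mulVf // mulr1.
rewrite !exprM -!exprVn [RHS]subrXX.
have -> : x^-1 ^+ 2 - y^-1 ^+ 2 = (y ^+ 2 - x ^+ 2) * x^-1 ^+ 2 * y^-1 ^+ 2.
  by field; apply/andP.
rewrite [LHS]mulrC -!mulrA; congr (_ * _).
rewrite !mulr_sumr (reindex_inj rev_ord_inj) /=.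
apply: eq_bigr => j _; rewrite subSS -!exprVn -exprM.
have -> : (q.+1 - (q - j) = j.+1)%N by have := ltn_ord j; lia.
rewrite !exprM !exprS; ring.
Qed.

(** After exchanging sums, the diagonal contributes q + 1 and the antisymmetric part 2 * 3/4,
    together q + 2 + 1/2. *)
Lemma zeta_partial_conv (R : realType) q N :
  \sum_(j < q.+1) zeta_partial R (2 * j.+1) N * zeta_partial R (2 * (q.+1 - j)) N
  = (q.+2%:R + 2^-1) * zeta_partial R (2 * q.+2) N - 2 * conv_error R q N.
Proof.
pose a (m : nat) : R := (m.+1%:R ^+ (2 * q.+1))^-1.
transitivity (\sum_(m < N) \sum_(n < N)
    ((m == n)%:R * (q.+1%:R * (m.+1%:R ^+ (2 * q.+2))^-1)
     + (a m - a n) * inv_sqr_diff R m n)).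
  under eq_bigr do rewrite /zeta_partial mulr_suml.
  rewrite exchange_big /=; apply: eq_bigr => m _.
  under eq_bigr do rewrite mulr_sumr.
  rewrite exchange_big /=; apply: eq_bigr => n _.
  by rewrite sum_geometric_pair.
under eq_bigr do rewrite big_split /=.
rewrite big_split /=.
have -> : \sum_(m < N) \sum_(n < N) (m == n)%:R * (q.+1%:R * (m.+1%:R ^+ (2 * q.+2))^-1)
   = q.+1%:R * zeta_partial R (2 * q.+2) N.
  rewrite mulr_sumr; apply: eq_bigr => m _.
  rewrite (bigD1 m) //= eqxx mul1r big1 ?addr0 // => n.
  by rewrite eq_sym => /negPf ->; rewrite mul0r.
have -> : \sum_(m < N) \sum_(n < N) (a m - a n) * inv_sqr_diff R m n =
    2 * \sum_(m < N) a m * \sum_(n < N) inv_sqr_diff R m n.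
  under eq_bigr => m _ do under eq_bigr => n _ do rewrite mulrBl.
  under eq_bigr do rewrite sumrB.
  rewrite sumrB [X in _ - X]exchange_big /= mulr_natl mulr2n; congr (_ + _).
    by apply: eq_bigr => m _; rewrite mulr_sumr.
  rewrite -sumrN; apply: eq_bigr => m _; rewrite mulr_sumr -sumrN.
  by apply: eq_bigr => n _; rewrite inv_sqr_diff_anti; ring.
have -> : \sum_(m < N) a m * \sum_(n < N) inv_sqr_diff R m n =
    3 / 4 * zeta_partial R (2 * q.+2) N - conv_error R q N.
  rewrite /conv_error mulr_sumr -sumrB; apply: eq_bigr => m _.
  have := sum_inv_sqr_diff R m (N - m.+1); rewrite subnKC // => ->.
  rewrite mulrBr; congr (_ - _).
  rewrite mulrCA /a -invfM -exprD; congr (_ * (_ ^+ _)^-1); lia.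
by rewrite -[q.+2%:R]natr1; field.
Qed.

Lemma zeta_conv (R : realType) q :
  \sum_(j < q.+1) zeta R (2 * j.+1) * zeta R (2 * (q.+1 - j))
  = (q.+2%:R + 2^-1) * zeta R (2 * q.+2).
Proof.
have cvgL : ((\sum_(j < q.+1) zeta_partial R (2 * j.+1) N *
      zeta_partial R (2 * (q.+1 - j)) N) @[N --> \oo] -->
    \sum_(j < q.+1) zeta R (2 * j.+1) * zeta R (2 * (q.+1 - j)))%classic.
  apply: cvg_big => [|j _]; first exact: add_continuous.
  apply: cvgM; apply: zeta_partial_cvg; first lia.
  by have := ltn_ord j; lia.
have cvge : (conv_error R q N @[N --> \oo] --> (0 : R))%classic.
  apply: (@squeeze_cvgr _ _ _ _ (fun=> 0) (fun N => 3 * harmonic N)).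
  - by apply: nearW => N; exact: conv_error_bounds.
  - exact: cvg_cst.
  - rewrite -[X in (_ --> X)%classic](mulr0 3); by apply: cvgM; [exact: cvg_cst|exact: cvg_harmonic].
have cvgR : ((q.+2%:R + 2^-1) * zeta_partial R (2 * q.+2) N - 2 * conv_error R q N
    @[N --> \oo] --> (q.+2%:R + 2^-1) * zeta R (2 * q.+2))%classic.
  rewrite -[X in (_ --> X)%classic]subr0 -[X in _ - X](mulr0 2).
  by apply: cvgB; apply: cvgM => //; [exact: cvg_cst|apply: zeta_partial_cvg; lia|exact: cvg_cst].
have E : (fun N => \sum_(j < q.+1) zeta_partial R (2 * j.+1) N *
      zeta_partial R (2 * (q.+1 - j)) N) =
    (fun N => (q.+2%:R + 2^-1) * zeta_partial R (2 * q.+2) N - 2 * conv_error R q N).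
  by apply/funext => N; exact: zeta_partial_conv.
by rewrite E in cvgL; exact: (cvg_unique (@norm_hausdorff _ _) cvgL cvgR).
Qed.

(** * Bernoulli numbers and the Riccati equation *)

Definition bern (i : nat) : rat := bernoulli_num i / i`!%:R.

Lemma factr_neq0 i : i`!%:R != 0 :> rat.
Proof. by rewrite pnatr_eq0 -lt0n fact_gt0. Qed.

Lemma bern0 : bern 0 = 1.
Proof. by rewrite /bern /bernoulli_num /fps_inv /= big_ord0 !fact0 !invr1 subr0 !mulr1. Qed.

Definition theta (p : {poly rat}) : {poly rat} := 'X * p^`().

Lemma coef_theta p i : (theta p)`_i = i%:R * p`_i.
Proof.
rewrite /theta coefXM; case: i => [|i] /=; first by rewrite mul0r.
by rewrite coef_deriv mulr_natl.
Qed.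

Lemma thetaD p q : theta (p + q) = theta p + theta q.
Proof. by rewrite /theta derivD mulrDr. Qed.

Lemma thetaM p q : theta (p * q) = theta p * q + p * theta q.
Proof. by rewrite /theta derivM; ring. Qed.

(* Congruence modulo 'X^N, i.e. equality of truncated power series. *)
Definition eqX (S : nzRingType) (N : nat) (p q : {poly S}) := forall i, (i < N)%N -> p`_i = q`_i.

Lemma eqX_refl (S : nzRingType) N (p : {poly S}) : eqX N p p. Proof. by []. Qed.

Lemma eqX_sym (S : nzRingType) N (p q : {poly S}) : eqX N p q -> eqX N q p.
Proof. by move=> h i iN; rewrite h. Qed.

Lemma eqX_trans (S : nzRingType) N (q p r : {poly S}) : eqX N p q -> eqX N q r -> eqX N p r.
Proof. by move=> h1 h2 i iN; rewrite h1 ?h2. Qed.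

Lemma eqXD (S : nzRingType) N (p q p' q' : {poly S}) : eqX N p p' -> eqX N q q' -> eqX N (p + q) (p' + q').
Proof. by move=> h1 h2 i iN; rewrite !coefD h1 ?h2. Qed.

Lemma eqXN (S : nzRingType) N (p q : {poly S}) : eqX N p q -> eqX N (- p) (- q).
Proof. by move=> h i iN; rewrite !coefN h. Qed.

Lemma eqXM (S : nzRingType) N (p q p' q' : {poly S}) : eqX N p p' -> eqX N q q' -> eqX N (p * q) (p' * q').
Proof.
move=> h1 h2 i iN; rewrite !coefM; apply: eq_bigr => j _.
by rewrite h1 ?h2 //; have := ltn_ord j; lia.
Qed.

Lemma eqX_prod (S : nzRingType) N I (r : seq I) (F G : I -> {poly S}) :
  (forall i, eqX N (F i) (G i)) -> eqX N (\prod_(i <- r) F i) (\prod_(i <- r) G i).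
Proof. by move=> FG; elim/big_rec2: _ => // i p q _ pq; apply: eqXM. Qed.

Lemma eqX_theta N p q : eqX N p q -> eqX N (theta p) (theta q).
Proof. by move=> h i iN; rewrite !coef_theta h. Qed.

(** Truncation of h, so that power series identities become congruences of polynomials modulo
    t^N. *)
Definition bern_poly (N : nat) : {poly rat} := \poly_(i < N) bern i.

(* Riccati equation of h = t / (e^t - 1). *)
Lemma theta_bern_poly N :
  eqX N (theta (bern_poly N))
        ((1 - 'X) * bern_poly N - bern_poly N ^+ 2).
Proof.
(* u truncates (e^t - 1) / t, the inverse of h; differentiating t u = e^t - 1 gives [tu]. *)
pose u : {poly rat} := \poly_(i < N) (i.+1`!%:R)^-1.
set h := bern_poly N.
have hu : eqX N (h * u) 1.
  move=> i iN; rewrite coef1 coefM.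
  rewrite -(@fps_invP (fun n => (n.+1`!%:R)^-1)) ?invr1 ?oner_neq0 //.
  apply: eq_bigr => j _; have ji := ltn_ord j.
  rewrite !coef_poly !ifT; [|lia|lia].
  by rewrite /bern /bernoulli_num [X in X * _]mulrAC divff ?factr_neq0 ?mul1r.
have tu : eqX N (theta u) ('X * u + 1 - u).
  move=> i iN; rewrite coef_theta coefB coefD coefXM coef1 !coef_poly iN.
  case: i iN => [|i] iN /=; first by rewrite mul0r invr1; ring.
  rewrite ifT; last lia.
  rewrite (factS i.+1) natrM invfM [i.+2%:R]mulrSr.
  have := factr_neq0 i.+1; have : i.+1%:R + 1 != 0 :> rat by rewrite -mulrSr pnatr_eq0.
  by move=> ? ?; field; apply/andP.
(* Since theta (h u) vanishes modulo t^N, multiplying by h u = 1 turns theta h into - h^2 theta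
   u. *)
have e1 : eqX N (theta h) (theta h * (h * u)).
  by rewrite -[X in eqX _ X _]mulr1; apply: eqXM => //; apply: eqX_sym.
apply: (eqX_trans e1).
have -> : theta h * (h * u) = h * theta (h * u) - h * (h * theta u).
  by rewrite thetaM; ring.
have e2 : eqX N (h * theta (h * u)) 0.
  have -> : 0 = h * theta 1 by rewrite /theta -[1]/(1%:P) derivC !mulr0.
  by apply: eqXM => //; apply: eqX_theta.
have e3 : eqX N (h * (h * theta u)) (h * ('X * 1 + h - 1)).
  apply: eqXM => //.
  apply: (@eqX_trans _ _ (h * ('X * u + 1 - u))); first exact: eqXM.
  have -> : h * ('X * u + 1 - u) = 'X * (h * u) + h - h * u by ring.
  by apply: eqXD; [apply: eqXD => //; apply: eqXM|apply: eqXN].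
have := eqXD e2 (eqXN e3); rewrite add0r => e4; apply: (eqX_trans e4).
by have -> : - (h * ('X * 1 + h - 1)) = (1 - 'X) * h - h ^+ 2 by ring.
Qed.

(* Coefficients of t / (e^t - 1) + t / 2. *)
Definition even_bern (i : nat) : rat := bern i + (i == 1%N)%:R / 2.

(** The coefficient of t^(i+1) in t E' = E - E^2 + t^2 / 4, with the two end terms of E^2, where E_0
    = 1, moved to the left. *)
Lemma even_bern_rec i : i.+2%:R * even_bern i.+1 =
  (i == 1%N)%:R / 4 - \sum_(j < i) even_bern j.+1 * even_bern (i - j).
Proof.
pose N := i.+2; pose E := bern_poly N + 2^-1 *: 'X.
have coefE j : (j < N)%N -> E`_j = even_bern j.
  by move=> jN; rewrite coefD coefZ coefX coef_poly jN mulrC.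
have : eqX N (theta E) (E - E ^+ 2 + 4^-1 *: 'X^2).
  rewrite thetaD; apply: (eqX_trans (eqXD (@theta_bern_poly N) (@eqX_refl _ N _))).
  have -> : theta (2^-1 *: 'X) = 2^-1 *: 'X.
    by rewrite /theta derivZ derivX -mulrC mulr_algl.
  have -> : (4^-1 : rat) = 2^-1 * 2^-1 by [].
  rewrite /E -!mul_polyC polyCM.
  have : 2 * (2^-1 : rat)%:P = 1 :> {poly rat}.
    by rewrite -(polyC_natr rat 2) -polyCM mulfV.
  set c := _%:P => c2.
  set h := bern_poly N.
  suff -> : (1 - 'X) * h - h ^+ 2 + c * 'X =
     h + c * 'X - (h + c * 'X) ^+ 2 + c * c * 'X^2 by [].
  have Xh : 'X * h = 2 * c * ('X * h) by rewrite c2 mul1r.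
  by rewrite mulrBl Xh; ring.
clearbody E; move=> /(_ i.+1 (leqnn _)).
rewrite coef_theta !coefD coefN coefZ coefXn expr2 coefM.
rewrite big_ord_recr big_ord_recl /= subnn subn0 !coefE //.
rewrite [X in _ = X -> _](_ : _ = even_bern i.+1 - (even_bern 0 * even_bern i.+1 +
   (\sum_(j < i) even_bern j.+1 * even_bern (i - j) + even_bern i.+1 * even_bern 0)) +
   4^-1 * (i == 1%N)%:R).
  have -> : even_bern 0 = 1 by rewrite /even_bern bern0 mul0r addr0.
  by rewrite -[i.+2%:R]natr1 => H; lra.
rewrite eqSS -addrA; congr (_ - (_ + (_ + _)) + _).
apply: eq_bigr => j _; have ji := ltn_ord j.
by rewrite !coefE ?/bump //= /N; lia.
Qed.

(** Strong induction on [even_bern_rec]: at an odd index every product has a factor of smaller odd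
    index, and the term 1/4 occurs only at index 2. *)
Lemma even_bern_odd i : odd i -> even_bern i = 0.
Proof.
elim/ltn_ind: i => -[|i] // IH oi.
have := even_bern_rec i.
rewrite big1 ?subr0 => [|j _]; last first.
  have ji := ltn_ord j.
  case oj: (odd j.+1); first by rewrite IH ?mul0r //; lia.
  by rewrite [X in _ * X]IH ?mulr0 //; lia.
case: eqP oi => [->//|_ _]; rewrite mul0r => /eqP.
by rewrite mulf_eq0 pnatr_eq0 /= => /eqP.
Qed.

Lemma even_bernE i : i != 1%N -> even_bern i = bern i.
Proof. by move=> /negPf i1; rewrite /even_bern i1 mul0r addr0. Qed.

Lemma bern2 : bern 2 = 12^-1.
Proof.
have := even_bern_rec 1.
by rewrite big_ord1 (@even_bern_odd 1) // mul0r even_bernE //=; lra.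
Qed.

Lemma sum_ord_double (V : nmodType) (f : nat -> V) n :
  \sum_(j < 2 * n) f j = \sum_(j < n) (f (2 * j)%N + f (2 * j).+1).
Proof.
elim: n => [|n IHn]; first by rewrite muln0 !big_ord0.
by rewrite mulnS !big_ord_recr /= IHn addrA.
Qed.

(** The factor is -2 times the q + 2 + 1/2 of [zeta_conv], so both sequences obey the same recursion
    up to scaling. *)
Lemma bern_conv q :
  \sum_(j < q.+1) bern (2 * j.+1) * bern (2 * (q.+1 - j))
  = - (2 * q.+2).+1%:R * bern (2 * q.+2).
Proof.
have := even_bern_rec (2 * q.+2).-1.
have -> : (2 * q.+2).-1 = (2 * q.+1).+1 by lia.
rewrite [_ == 1%N]gtn_eqF // mul0r sub0r.
have -> : (2 * q.+1).+2 = (2 * q.+2)%N by lia.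
rewrite even_bernE; last lia.
rewrite mulNr => ->; rewrite opprK.
rewrite [RHS]big_ord_recr /= even_bern_odd ?mul0r ?addr0 /=; last by lia.
rewrite (sum_ord_double (fun j => even_bern j.+1 * even_bern ((2 * q.+1).+1 - j))).
apply: eq_bigr => j _; have jq := ltn_ord j.
rewrite even_bern_odd ?mul0r ?add0r /=; last by lia.
by rewrite !even_bernE; [congr (bern _ * bern _); lia|lia|lia].
Qed.

(** * The polynomials f_{mi} and the derivation on Q[t][H] *)

Lemma f_gt m i : (m.+1 < i)%N -> f_ m i = 0.
Proof. by case: m => [|m]; case: i => [|[|i]] //= im; rewrite !ifN //; lia. Qed.

(** The vanishing of f_{mi} for i > m + 1 absorbs the boundary cases into a single recursion, the
    one of [coef_der]. *)
Lemma f_rec m i : f_ m.+1 i =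
  theta (f_ m i) + i%:R *: ((1 - 'X) * f_ m i) - (i.-1)%:R *: f_ m i.-1.
Proof.
have theta0 : theta 0 = 0 by rewrite /theta linear0 mulr0.
case: i => [|i]; first by rewrite /= !scale0r addr0 subr0.
rewrite /=; case: (leqP i.+1 m.+1) => mi; first by [].
rewrite (@f_gt m i.+1) // theta0 mulr0 scaler0 !add0r eqSS.
by case: eqP => [->//|ne]; rewrite f_gt ?scaler0 ?oppr0 //; lia.
Qed.

Local Notation bipoly := {poly {poly rat}}.

(* The derivation of Q[t][H] extending t d/dt with H standing for t / (e^t - 1). *)
Definition der (P : bipoly) : bipoly :=
  map_poly theta P + P^`() * ('X * (1 - 'X)%:P - 'X^2).

Lemma coef_map_theta (P : bipoly) i : (map_poly theta P)`_i = theta P`_i.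
Proof. by rewrite coef_map_id0 // /theta linear0 mulr0. Qed.

Lemma map_thetaD (P Q : bipoly) :
  map_poly theta (P + Q) = map_poly theta P + map_poly theta Q.
Proof. by apply/polyP => i; rewrite !(coefD, coef_map_theta) thetaD. Qed.

Lemma theta_sum I (r : seq I) (F : I -> {poly rat}) :
  theta (\sum_(i <- r) F i) = \sum_(i <- r) theta (F i).
Proof. by rewrite /theta raddf_sum mulr_sumr. Qed.

Lemma map_thetaM (P Q : bipoly) :
  map_poly theta (P * Q) = map_poly theta P * Q + P * map_poly theta Q.
Proof.
apply/polyP => i; rewrite coefD coef_map_theta !coefM theta_sum -big_split /=.
by apply: eq_bigr => j _; rewrite thetaM !coef_map_theta.
Qed.

Lemma derD P Q : der (P + Q) = der P + der Q.
Proof. by rewrite /der map_thetaD derivD mulrDl addrACA. Qed.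

Lemma derM P Q : der (P * Q) = der P * Q + P * der Q.
Proof. by rewrite /der map_thetaM derivM; ring. Qed.

Lemma derC c : der c%:P = (theta c)%:P.
Proof.
rewrite /der derivC mul0r addr0; apply/polyP => i.
by rewrite coef_map_theta !coefC; case: eqP => // _; rewrite /theta linear0 mulr0.
Qed.

Lemma derX : der 'X = 'X * (1 - 'X)%:P - 'X^2.
Proof.
rewrite /der derivX mul1r -[RHS]add0r; congr (_ + _); apply/polyP => i.
rewrite coef_map_theta coefX coef0.
by case: eqP => _; rewrite /theta ?linear0 ?mulr0 // -[1%:R]/(1%:P) derivC mulr0.
Qed.

Lemma coef_der P i : (der P)`_i =
  theta P`_i + i%:R *: ((1 - 'X) * P`_i) - (i.-1)%:R *: P`_i.-1.
Proof.
rewrite /der coefD coef_map_theta -addrA; congr (_ + _).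
rewrite mulrBr coefB mulrA coefMC coefMX coefMXn !scaler_nat.
case: i => [|[|i]] /=; rewrite ?coef_deriv; first by rewrite !mulr0n mul0r.
  by rewrite !mulr1n mulr0n mulrC.
by rewrite subn2 /= mulrnAl mulrC.
Qed.

(* Image of (t d/dt)^m (\sum_(k >= 1) B_{2k} / (2k)! t^{2k}). *)
Definition Pm (m : nat) : bipoly := iter m der ('X + (2^-1 *: 'X - 1)%:P).

Lemma coef_Pm m i : (Pm m)`_i = f_ m i.
Proof.
elim: m i => [|m IHm] i; last by rewrite f_rec -!IHm -coef_der.
by rewrite coefD coefX coefC; case: i => [|[|i]] /=; rewrite ?add0r ?addr0.
Qed.

(** * Reflection symmetry *)

(* The substitution t |-> -t, H |-> H + t, which reflects
   h(-t) = h(t) + t for h(t) = t / (e^t - 1). *)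
Definition refl_sub (P : bipoly) : bipoly :=
  map_poly (comp_poly (- 'X)) P \Po ('X + 'X%:P).

Lemma refl_subD P Q : refl_sub (P + Q) = refl_sub P + refl_sub Q.
Proof. by rewrite /refl_sub !rmorphD. Qed.

Lemma refl_subB P Q : refl_sub (P - Q) = refl_sub P - refl_sub Q.
Proof. by rewrite /refl_sub !rmorphB. Qed.

Lemma refl_subM P Q : refl_sub (P * Q) = refl_sub P * refl_sub Q.
Proof. by rewrite /refl_sub rmorphM /= comp_polyM. Qed.

Lemma refl_subC c : refl_sub c%:P = (c \Po - 'X)%:P.
Proof. by rewrite /refl_sub map_polyC /= comp_polyC. Qed.

Lemma refl_subX : refl_sub 'X = 'X + 'X%:P.
Proof. by rewrite /refl_sub map_polyX comp_polyX. Qed.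

Lemma theta_comp_oppX p : theta (p \Po - 'X) = theta p \Po - 'X.
Proof.
rewrite /theta deriv_comp derivN derivX comp_polyM comp_polyX; ring.
Qed.

(** Both sides satisfy the same twisted Leibniz rule, so it suffices to compare them on Q[t] and at
    H, where both are (H + t)(1 - H) = (1 - t) H - H^2 + t. *)
Lemma refl_sub_der P : refl_sub (der P) = der (refl_sub P).
Proof.
elim/poly_ind: P => [|P c IHP].
  by rewrite -polyC0 derC refl_subC !derC refl_subC theta_comp_oppX.
rewrite derD derM derC [in RHS]refl_subD [in RHS]refl_subM.
rewrite refl_subD (refl_subD (_ * 'X)) !refl_subM IHP.
rewrite !refl_subC refl_subX derD derM (derD 'X) !derC.
rewrite theta_comp_oppX derX; congr (_ + _ * _ + _).
rewrite refl_subB expr2 !refl_subM !refl_subC !refl_subX.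
have -> : (1 - 'X) \Po - 'X = 1 + 'X :> {poly rat}.
  by rewrite comp_polyB comp_polyX -polyC1 comp_polyC opprK.
rewrite /theta derivX mulr1 polyCB polyCD polyC1.
set t := 'X%:P; ring.
Qed.

Lemma refl_sub_Pm m : refl_sub (Pm m) = Pm m.
Proof.
elim: m => [|m IHm]; last by rewrite /= refl_sub_der IHm.
rewrite /= refl_subD refl_subX refl_subC -addrA -polyCD; congr (_ + _%:P).
rewrite comp_polyB comp_polyZ comp_polyX -polyC1 comp_polyC scalerN addrA.
congr (_ - _).
by rewrite -[X in X - _]scale1r -scalerBl.
Qed.

Lemma refl_sub_prod I (r : seq I) (F : I -> bipoly) :
  refl_sub (\prod_(i <- r) F i) = \prod_(i <- r) refl_sub (F i).
Proof.
elim/big_rec2: _ => [|i _ Q _ <-]; last by rewrite refl_subM.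
by rewrite -[1]/(1%:P%:P) refl_subC comp_polyC.
Qed.

Lemma refl_sub_sum I (r : seq I) (F : I -> bipoly) :
  refl_sub (\sum_(i <- r) F i) = \sum_(i <- r) refl_sub (F i).
Proof.
elim/big_rec2: _ => [|i _ Q _ <-]; last by rewrite refl_subD.
by rewrite -polyC0 refl_subC comp_poly0.
Qed.

(** * Total degree *)

(* Total degree at most d in t and H. *)
Definition tdeg (d : nat) (P : bipoly) :=
  forall i j, (d < i + j)%N -> P`_i`_j = 0.

Lemma tdegB d P Q : tdeg d P -> tdeg d Q -> tdeg d (P - Q).
Proof. by move=> hP hQ i j ij; rewrite !coefB hP ?hQ ?subr0. Qed.

Lemma tdegM d e P Q : tdeg d P -> tdeg e Q -> tdeg (d + e) (P * Q).
Proof.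
move=> hP hQ i j ij; rewrite coefM coef_sum big1 // => a _.
have ai := ltn_ord a; rewrite coefM big1 // => b _; have bj := ltn_ord b.
have [h|h] := ltnP d (a + b); first by rewrite hP ?mul0r.
by rewrite hQ ?mulr0 //; lia.
Qed.

(** Each application of [der] raises the total degree by at most one. *)
Lemma tdeg_Pm m : tdeg m.+1 (Pm m).
Proof.
move=> i j; rewrite coef_Pm.
elim: m i j => [|m IHm] i j ij.
  case: i ij => [|[|i]] ij; rewrite /= ?coef0 //.
    by rewrite coefB coefZ coefX coef1; case: j ij => [|[|]] //= _; rewrite mulr0 subr0.
  by rewrite coef1; case: j ij.
rewrite f_rec coefB coefD coef_theta !coefZ mulrBl mul1r coefB coefXM.
rewrite !IHm; [|lia..].
case: i ij => [|i] ij; case: j ij => [|j] ij /=; rewrite ?IHm ?mulr0 ?mul0r ?subr0 ?addr0 //; lia.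
Qed.

Lemma tdeg_prod n (m : 'I_n -> nat) :
  tdeg (\sum_(j < n) m j + n) (\prod_(j < n) Pm (m j)).
Proof.
have -> : (\sum_(j < n) m j + n = \sum_(j < n) (m j).+1)%N.
  by under [RHS]eq_bigr do rewrite -addn1; rewrite big_split /= sum1_card card_ord.
elim/big_rec2: _ => [|i d P _ IH]; last exact: tdegM (@tdeg_Pm _) IH.
by case=> [|i] [|j] //=; rewrite !coefE.
Qed.

Lemma coef_CM (c : {poly rat}) (P : bipoly) i : (c%:P * P)`_i = c * P`_i.
Proof. by rewrite mul_polyC coefZ. Qed.

(** * Expansions in 1, P_0, ..., P_{K-1} over Q[t] *)

Definition Pm_comb (K : nat) (c : {poly rat}) (a : nat -> {poly rat}) : bipoly :=
  c%:P + \sum_(j < K) (a j)%:P * Pm j.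

Lemma Pm_combS K c a : Pm_comb K.+1 c a = Pm_comb K c a + (a K)%:P * Pm K.
Proof. by rewrite /Pm_comb big_ord_recr addrA. Qed.

Lemma coef_Pm_comb_top K c a : (Pm_comb K.+1 c a)`_K.+1 =
  ((-1) ^+ K * K`!%:R) *: a K.
Proof.
rewrite Pm_combS coefD coef_CM coef_Pm f_diag mulrC mul_polyC.
rewrite /Pm_comb coefD coefC coef_sum big1 ?addr0 ?add0r // => j _.
by rewrite coef_CM coef_Pm f_gt ?mulr0 // ltnS.
Qed.

Lemma diag_neq0 K : (-1) ^+ K * K`!%:R != 0 :> rat.
Proof. by rewrite mulf_neq0 ?signr_eq0 ?factr_neq0. Qed.

(** P_K has degree K + 1 in H with constant leading coefficient (-1)^K K!, so the coefficients
    vanish one by one from the top. *)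
Lemma Pm_comb_eq0 K c a : Pm_comb K c a = 0 ->
  c = 0 /\ forall j, (j < K)%N -> a j = 0.
Proof.
elim: K => [|K IHK] H.
  by split=> //; apply/polyC_inj; move: H; rewrite /Pm_comb big_ord0 addr0.
have aK : a K = 0.
  have := coef_Pm_comb_top K c a; rewrite H coef0 => /esym/eqP.
  by rewrite scaler_eq0 (negPf (diag_neq0 K)) => /eqP.
move: H; rewrite Pm_combS aK mul0r addr0 => /IHK[c0 a0]; split=> // j.
by rewrite ltnS leq_eqVlt => /orP[/eqP->//|/a0].
Qed.

(** The top coefficient in H bounds deg a_K by d - K - 1, so a_K P_K has total degree at most d and
    can be subtracted before the induction. *)
Lemma Pm_comb_tdeg d K c a : tdeg d (Pm_comb K c a) ->
  forall j i, (j < K)%N -> (d < i + j.+1)%N -> (a j)`_i = 0.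
Proof.
elim: K => [//|K IHK] H.
have aK i : (d < i + K.+1)%N -> (a K)`_i = 0.
  move=> di; have /eqP := H K.+1 i (ltac:(lia)); rewrite coef_Pm_comb_top coefZ.
  by rewrite mulf_eq0 (negPf (diag_neq0 K)) => /eqP.
have H' : tdeg d (Pm_comb K c a).
  have -> : Pm_comb K c a = Pm_comb K.+1 c a - (a K)%:P * Pm K.
    by rewrite Pm_combS addrK.
  apply: tdegB => //; have [le|lt] := leqP K.+1 d.
    rewrite -(subnK le); apply: tdegM (@tdeg_Pm K) => -[|i] j ij.
      by rewrite coefC aK //; lia.
    by rewrite coefC coef0.
  (* For d < K + 1 the bound kills every coefficient of a_K. *)
  have -> : a K = 0 by apply/polyP => i; rewrite coef0 aK //; lia.
  by rewrite mul0r => i j _; rewrite !coef0.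
move=> j i; rewrite ltnS leq_eqVlt => /orP[/eqP->|jK]; first exact: aK.
exact: IHK.
Qed.

(** As [refl_sub] fixes each P_j, it acts only on the coefficients, and the expansion is unique. *)
Lemma Pm_comb_refl K c a : refl_sub (Pm_comb K c a) = Pm_comb K c a ->
  c \Po - 'X = c /\ forall j, (j < K)%N -> a j \Po - 'X = a j.
Proof.
move=> /eqP; rewrite -subr_eq0 => /eqP H.
have {}H : Pm_comb K (c \Po - 'X - c) (fun j => a j \Po - 'X - a j) = 0.
  rewrite -[RHS]H /Pm_comb refl_subD refl_subC refl_sub_sum opprD addrACA -polyCB.
  congr (_ + _); rewrite -sumrB; apply: eq_bigr => j _.
  by rewrite refl_subM refl_subC refl_sub_Pm polyCB mulrBl.
have [c0 a0] := Pm_comb_eq0 H.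
split; first by apply/eqP; rewrite -subr_eq0 c0.
by move=> j /a0 aj; apply/eqP; rewrite -subr_eq0 aj.
Qed.

Lemma coef_even_odd (p : {poly rat}) i : p \Po - 'X = p -> odd i -> p`_i = 0.
Proof.
move=> pe oi; have := congr1 (fun q : {poly rat} => q`_i) pe => /=.
have -> : (p \Po - 'X)`_i = (-1) ^+ i * p`_i.
  rewrite coef_comp_poly; have Xn j : (- 'X) ^+ j = (-1) ^+ j *: 'X^j :> {poly rat}.
    by rewrite -scaleN1r exprZn.
  under eq_bigr do rewrite Xn coefZ coefXn.
  have [ip|pi] := ltnP i (size p).
    rewrite (bigD1 (Ordinal ip)) //= eqxx mulr1 mulrC big1 ?addr0 // => j.
    by rewrite -val_eqE /= eq_sym => /negPf ->; rewrite !mulr0.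
  rewrite [p`_i]nth_default // mulr0 big1 // => j _.
  by rewrite gtn_eqF ?mulr0 //; apply: leq_trans pi.
rewrite -signr_odd oi expr1 mulN1r => H; lra.
Qed.

(** * Products of the P_m and the polynomials F_j *)

Lemma coef_prod_ffun (S : comNzRingType) n K (p : 'I_n -> {poly S}) :
  (\prod_(j < n) p j)`_K =
  \sum_(c : {ffun 'I_n -> 'I_K.+1} | (\sum_(j < n) c j == K)%N)
    \prod_(j < n) (p j)`_(c j).
Proof.
(* Truncating each factor at degree K fits the index type of c and keeps the coefficient of degree
   K. *)
have E : eqX K.+1 (\prod_(j < n) p j)
    (\prod_(j < n) \sum_(i < K.+1) (p j)`_i *: 'X^i).
  apply: eqX_prod => j i iK; rewrite coef_sum (bigD1 (Ordinal iK)) //=.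
  rewrite coefZ coefXn eqxx mulr1 big1 ?addr0 // => a.
  by rewrite -val_eqE /= eq_sym coefZ coefXn => /negPf ->; rewrite mulr0.
rewrite (E K (leqnn _)) bigA_distr_bigA /= coef_sum [RHS]big_mkcond /=.
apply: eq_bigr => c _; rewrite scaler_prod.
by rewrite prodrXr coefZ coefXn eq_sym; case: eqP; rewrite ?mulr1 ?mulr0.
Qed.

Lemma fsumE n (m : 'I_n -> nat) i : fsum m i = (\prod_(j < n) Pm (m j))`_i.
Proof.
rewrite coef_prod_ffun /fsum big_mkcondr /=; apply: eq_bigr => c _.
under [RHS]eq_bigr do rewrite coef_Pm.
case: ifPn => // /forallPn[j]; rewrite -ltnNge => jc.
by rewrite (bigD1 j) //= f_gt // mul0r.
Qed.

(** Induction on the row: entry (i, j) of A A^-1 = 1 reduces to a nonzero constant, the diagonal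
    entry of A, times the entry sought. *)
Lemma Amx_inv_trig K (i j : 'I_K.+1) : (i < j)%N -> invmx (Amx K) i j = 0.
Proof.
have [d] := ubnP i; elim: d => // d IHd in i *; rewrite ltnS => id ij.
have /matrixP/(_ i j) := mulmxV (Amx_unit K).
rewrite !mxE -val_eqE (ltn_eqF ij) (bigD1 i) //= big1 ?addr0 => [|c ci].
  rewrite mxE leqnn f_diag => /eqP; rewrite mul_polyC scaler_eq0.
  by rewrite (negPf (diag_neq0 _)) => /eqP.
rewrite mxE; case: leqP => [le|_]; last by rewrite mul0r.
have lt : (c < i)%N by rewrite ltn_neqAle le andbT.
by rewrite IHd ?mulr0 //; [exact: leq_trans id|exact: ltn_trans ij].
Qed.

(** The row (F_1, ..., F_N) is (f_1, ..., f_N) A^-1; the sum in [F_] starts at j because A^-1 is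
    lower triangular. *)
Lemma F_rel n (m : 'I_n -> nat) (N := (\sum_(j < n) m j + n)%N) i :
  (0 < i <= N)%N -> \sum_(j < N) F_ m j.+1 * f_ j i = fsum m i.
Proof.
rewrite /F_ -/N; case: N => [|K]; first by case: i.
case: i => // i /= iK.
pose v : 'rV[{poly rat}]_K.+1 := \row_c fsum m c.+1.
pose w := v *m invmx (Amx K).
have wE (j : 'I_K.+1) : w 0 j =
    \sum_(j.+1 <= a < K.+2) fsum m a * g_ K a.-1 j.+1.
  rewrite big_add1 /= mxE.
  transitivity (\sum_(0 <= a < K.+1) fsum m a.+1 * g_ K a j.+1).
    rewrite big_mkord; apply: eq_bigr => c _.
    by rewrite mxE /g_ /= !inord_val.
  rewrite (@big_cat_nat _ _ _ j) ?(ltnW (ltn_ord j)) //= big_nat big1 ?add0r // => a aj.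
  by rewrite /g_ /= inord_val Amx_inv_trig ?mulr0 // inordK //; have := ltn_ord j; lia.
have /matrixP/(_ 0 (inord i)) : w *m Amx K = v by rewrite mulmxKV ?Amx_unit.
rewrite !mxE inordK // => <-; apply: eq_bigr => j _.
rewrite -wE [Amx K _ _]mxE inordK //; case: leqP => // ji.
by rewrite f_gt.
Qed.

Definition comb_const n (m : 'I_n -> nat) : {poly rat} :=
  fsum m 0 - \sum_(j < \sum_(i < n) m i + n) F_ m j.+1 * f_ j 0.

(** Compare coefficients of H^i: i = 0 defines [comb_const], 1 <= i <= N is [F_rel], and beyond N
    both sides vanish. *)
Lemma prod_Pm n (m : 'I_n -> nat) :
  \prod_(j < n) Pm (m j) =
  Pm_comb (\sum_(i < n) m i + n) (comb_const m) (fun j => F_ m j.+1).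
Proof.
apply/polyP => i; rewrite /Pm_comb coefD coefC coef_sum.
under [X in _ + X]eq_bigr do rewrite coef_CM coef_Pm.
case: i => [|i] /=; first by rewrite subrK fsumE.
rewrite add0r; have [iN|Ni] := leqP i.+1 (\sum_(i < n) m i + n).
  by rewrite F_rel // fsumE.
rewrite [RHS]big1 => [|j _]; last first.
  by rewrite f_gt ?mulr0 // ltnS; apply: leq_trans (ltn_ord j) _.
by apply/polyP => j; rewrite tdeg_prod ?coef0 //; lia.
Qed.

(** * Parity, degree and vanishing of the a_{jl} *)

Lemma F_even n (m : 'I_n -> nat) :
  comb_const m \Po - 'X = comb_const m /\
  forall j, (j < \sum_(i < n) m i + n)%N -> F_ m j.+1 \Po - 'X = F_ m j.+1.
Proof.
apply: Pm_comb_refl; rewrite -prod_Pm refl_sub_prod.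
by apply: eq_bigr => j _; exact: refl_sub_Pm.
Qed.

Lemma F_degree n (m : 'I_n -> nat) j i : (j < \sum_(i < n) m i + n)%N ->
  (\sum_(i < n) m i + n < i + j.+1)%N -> (F_ m j.+1)`_i = 0.
Proof.
apply: (@Pm_comb_tdeg _ _ (comb_const m) (fun j => F_ m j.+1)).
by rewrite -prod_Pm; exact: (@tdeg_prod n m).
Qed.

Lemma f_m0 m : f_ m 0 = 2^-1 *: 'X - (m == 0%N)%:R.
Proof.
elim: m => [//|m IHm]; rewrite f_rec IHm !scale0r addr0 subr0 /theta.
by rewrite derivB derivZ derivX -polyC_natr derivC !subr0 mulrC mulr_algl.
Qed.

(** The coefficient of H^0 in each P_m has degree at most 1 in t. *)
Lemma coef_fsum0 n (m : 'I_n -> nat) i : (n < i)%N -> (fsum m 0)`_i = 0.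
Proof.
move=> ni; rewrite fsumE coef0_prod nth_default //.
apply: leq_trans (size_prod_leq _ _) _.
rewrite leq_subLR.
have : (\sum_(j < n) size ((Pm (m j))`_0)%R <= \sum_(j < n) 2)%N.
  apply: leq_sum => j _; apply/leq_sizeP => k k2; rewrite coef_Pm.
  rewrite f_m0 coefB coefZ coefX -polyC_natr coefC.
  by case: k k2 => [|[|k]] //= _; rewrite mulr0 subr0.
by rewrite sum_nat_const !card_ord; set s := (\sum_(_ < _) _)%N; lia.
Qed.

(** By [f_m0], C = f_0 + F_1 - (t / 2) (F_1 + ... + F_N), the summand F_1 coming from the constant
    -1 in f_{00}. *)
Lemma coef_comb_const n (m : 'I_n -> nat) i : (0 < n)%N ->
  (comb_const m)`_i.+1 = (fsum m 0)`_i.+1 + (F_ m 1)`_i.+1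
    - 2^-1 * \sum_(j < \sum_(i < n) m i + n) (F_ m j.+1)`_i.
Proof.
move=> n0; rewrite /comb_const; set N := (_ + n)%N.
have N0 : (0 < N)%N by rewrite addn_gt0 n0 orbT.
have H (j : 'I_N) : (F_ m j.+1 * f_ j 0)`_i.+1 =
    2^-1 * (F_ m j.+1)`_i - (j == Ordinal N0)%:R * (F_ m 1)`_i.+1.
  rewrite f_m0 mulrBr coefB -scalerAr coefZ coefMX -val_eqE /=; congr (_ - _).
  by case: eqP => [->|_]; rewrite ?mulr1 ?mul1r ?mulr0 ?mul0r ?coef0.
have -> : (fsum m 0 - \sum_(j < N) F_ m j.+1 * f_ j 0)`_i.+1 = (fsum m 0)`_i.+1 -
    \sum_(j < N) (2^-1 * (F_ m j.+1)`_i - (j == Ordinal N0)%:R * (F_ m 1)`_i.+1).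
  rewrite coefB; congr (_ - _).
  by rewrite coef_sum; apply: eq_bigr => j _; exact: H.
have D1 (x : rat) : \sum_(j < N) (j == Ordinal N0)%:R * x = x.
  rewrite (bigD1 (Ordinal N0)) // big1 => [|j /negPf ->]; rewrite ?mul0r //.
  by rewrite eqxx mul1r [LHS]addr0.
by rewrite sumrB -mulr_sumr D1 opprB addrA.
Qed.

(** Let N = M + n be odd. The coefficient of t^N in C is zero by parity; there f_0 drops out as n <
    N, F_1 by degree, and of the sum of the F_j only the coefficient of t^(N-1) in F_1 survives. *)
Lemma a_top n (m : 'I_n -> nat) : (0 < n)%N -> (0 < \sum_(i < n) m i)%N ->
  odd (\sum_(i < n) m i + n) -> (F_ m 1)`_(\sum_(i < n) m i + n).-1 = 0.
Proof.
move=> n0 M0 oN.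
have Ce := coef_even_odd (proj1 (F_even m)) oN.
have Fd := @F_degree n m; have Cc i := coef_comb_const m i n0.
move: M0 oN Ce Fd Cc; move: (\sum_(i < n) m i)%N => M M0 oN Ce Fd Cc.
have N1 : (0 < M + n)%N by lia.
have NK : (M + n = (M + n).-1.+1)%N by lia.
move: Ce; rewrite NK Cc -NK coef_fsum0 ?(Fd 0%N (M + n)%N) ?add0r; [|lia..].
rewrite (bigD1 (Ordinal N1)) // big1 => [|j]; last first.
  by rewrite -val_eqE /= => j0; rewrite Fd ?ltn_ord //; lia.
by rewrite /= addr0 => /eqP; rewrite oppr_eq0 mulf_eq0 invr_eq0 /= => /eqP.
Qed.

Lemma a_eq0 n (m : 'I_n -> nat) j l (M := (\sum_(i < n) m i)%N) :
  (0 < n)%N -> (j < M + n)%N ->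
  (maxn ((M + n - 2) %/ 2) ((n - 1) %/ 2) < l)%N || (M + n - 2 * l <= j)%N ->
  a_ m j.+1 l = 0.
Proof.
move=> n0; rewrite /a_; have Fd := @F_degree n m; have Ft := a_top n0.
move: Fd (Ft m); rewrite /M; move: (\sum_(i < n) m i)%N => {Ft}M Fd Ft jN H.
have [d|d] := ltnP (M + n) (2 * l + j.+1); first by rewrite Fd.
(* Otherwise l > T, which leaves j = 0 and 2l = M + n - 1; the second entry of the maximum T rules
   out M = 0. *)
have j0 : j = 0%N by lia.
have -> : (2 * l = (M + n).-1)%N by lia.
by rewrite j0 Ft //; lia.
Qed.

(** * Evaluation at H = h *)

(** Evaluation at h turns [der] into t d/dt: both are derivations, and at H the claim is the Riccati
    equation. *)
Lemma theta_horner N (P : bipoly) :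
  eqX N (theta P.[bern_poly N]) (der P).[bern_poly N].
Proof.
elim/poly_ind: P => [|P c IHP]; first by rewrite -polyC0 derC !hornerC.
rewrite derD derM derC derX; move: (der P) IHP => Q IHP; rewrite !(hornerD, hornerM, hornerX, hornerC, hornerN, hornerXn).
rewrite thetaD thetaM.
apply: eqXD => //; apply: eqXD; apply: eqXM => //.
by rewrite [_ * (1 - 'X)]mulrC -expr2; exact: (@theta_bern_poly N).
Qed.

Lemma coef_iter_theta m p i : (iter m theta p)`_i = i%:R ^+ m * p`_i.
Proof.
by elim: m => [|m IHm] /=; rewrite ?expr0 ?mul1r // coef_theta IHm mulrA -exprS.
Qed.

Lemma Pm_horner N m :
  eqX N (Pm m).[bern_poly N] (iter m theta (Pm 0).[bern_poly N]).
Proof.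
elim: m => [//|m IHm]; apply: (eqX_trans (eqX_sym (@theta_horner N (Pm m)))).
exact: eqX_theta.
Qed.

Lemma coef_Pm0_horner N i : (i < N)%N ->
  (Pm 0).[bern_poly N]`_i = even_bern i - (i == 0%N)%:R.
Proof.
move=> iN; rewrite /Pm /= hornerD hornerX hornerC addrA coefB coef1.
by rewrite coefD coefZ coefX coef_poly iN mulrC.
Qed.

(* The series of the (2i)^m B_{2i} / (2i)!, i >= 1, in the variable t^2. *)
Definition even_bern_poly (k m : nat) : {poly rat} :=
  \poly_(i < k.+1) (if i == 0%N then 0 else (2 * i)%:R ^+ m * bern (2 * i)).

(** P_m at h is (t d/dt)^m applied to E - 1, whose constant and odd coefficients vanish. *)
Lemma Pm_horner_even k m :
  eqX (2 * k).+1 (Pm m).[bern_poly (2 * k).+1] (even_bern_poly k m \Po 'X^2).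
Proof.
move=> i ik; rewrite Pm_horner // coef_iter_theta coef_Pm0_horner //.
rewrite coef_comp_poly_Xn //; case: ifPn => [/dvdnP[q]|].
  rewrite mulnC => iE; rewrite {}iE in ik *.
  rewrite mulKn // coef_poly ifT; last lia.
  case: q ik => [|q] ik; first by rewrite /even_bern bern0 mul0r addr0 subrr mulr0.
  by rewrite even_bernE ?subr0 //; lia.
rewrite dvdn2 negbK => oi; rewrite even_bern_odd //.
by case: i oi ik => // i _ _; rewrite subr0 mulr0.
Qed.

Lemma even_poly_comp (p : {poly rat}) : p \Po - 'X = p -> p = even_poly p \Po 'X^2.
Proof.
move=> pe; apply/polyP => i; rewrite coef_comp_poly_Xn // coef_even_poly.
case: ifPn; last by rewrite dvdn2 negbK => /(coef_even_odd pe).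
by move=> i2; rewrite -muln2 divnK.
Qed.

Lemma eqX_sum (S : nzRingType) N I (r : seq I) (F G : I -> {poly S}) :
  (forall i, eqX N (F i) (G i)) -> eqX N (\sum_(i <- r) F i) (\sum_(i <- r) G i).
Proof. by move=> FG; elim/big_rec2: _ => // i p q _ pq; apply: eqXD. Qed.

(** This is the coefficient of t^{2k} in [prod_Pm] at H = h; the zero constant term of
    [even_bern_poly] accounts for c_j >= 1. *)
Lemma sum_prod_bern n k (m : 'I_n -> nat) : (0 < n)%N -> (n <= k)%N ->
  \sum_(c : {ffun 'I_n -> 'I_k.+1} |
          (\sum_(j < n) c j == k)%N && [forall j, (1 <= c j)%N])
     \prod_(j < n) ((2 * c j)%:R ^+ m j * bern (2 * c j))
  = \sum_(l < k.+1) \sum_(j < \sum_(i < n) m i + n)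
      a_ m j.+1 l * ((2 * (k - l))%:R ^+ j * bern (2 * (k - l))).
Proof.
move=> n0 nk; set N := (_ + n)%N.
have E : eqX (2 * k).+1 ((\prod_(j < n) even_bern_poly k (m j)) \Po 'X^2)
   (comb_const m + \sum_(j < N) F_ m j.+1 * (even_bern_poly k j \Po 'X^2)).
  rewrite rmorph_prod /=.
  apply: (@eqX_trans _ _ (\prod_(j < n) (Pm (m j)).[bern_poly (2 * k).+1])).
    by apply: eqX_prod => j; apply: eqX_sym; exact: Pm_horner_even.
  rewrite -horner_prod prod_Pm /Pm_comb hornerD hornerC horner_sum -/N.
  apply: eqXD => //; apply: eqX_sum => j; rewrite hornerM hornerC.
  by apply: eqXM => //; exact: Pm_horner_even.
have {E} := E (2 * k)%N (leqnn _).
rewrite coef_comp_poly_Xn // dvdn_mulr // mulKn // coef_prod_ffun => E.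
transitivity (\sum_(c : {ffun 'I_n -> 'I_k.+1} | (\sum_(j < n) c j == k)%N)
    \prod_(j < n) (even_bern_poly k (m j))`_(c j)).
  rewrite big_mkcondr; apply: eq_bigr => c _; case: ifPn => [/forallP c1|].
    apply: eq_bigr => j _; rewrite coef_poly ltn_ord ifN // -lt0n; exact: c1.
  move=> /forallPn[j]; rewrite -leqNgt leqn0 => cj.
  by rewrite (bigD1 j) //= coef_poly ltn_ord cj mul0r.
have [_ Fe] := F_even m.
rewrite {}E coefD coef_sum.
(* As n < 2k, f_0 has no term in t^{2k}, and the odd coefficients of the F_j vanish, so only F_1
   contributes. *)
have -> : (comb_const m)`_(2 * k) = a_ m 1 k.
  have -> : (2 * k = (2 * k).-1.+1)%N by lia.
  rewrite coef_comb_const // coef_fsum0 ?add0r; last lia.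
  rewrite big1 ?mulr0 ?subr0 => [|j _].
    by rewrite /a_; congr (_`_ _); lia.
  by apply: coef_even_odd; [exact: Fe|lia].
under eq_bigr => j _.
  rewrite (even_poly_comp (Fe j (ltn_ord j))) -comp_polyM coef_comp_poly_Xn //.
  rewrite dvdn_mulr // mulKn // coefM.
  under eq_bigr do rewrite coef_even_poly -mul2n -/(a_ m _ _).
  over.
rewrite exchange_big /= big_ord_recr [RHS]big_ord_recr /= addrCA.
congr (_ + _).
  apply: eq_bigr => l _; apply: eq_bigr => j _; have lk := ltn_ord l.
  by rewrite coef_poly ifT ?ifN //; lia.
(* At l = k, [even_bern_poly] contributes 0, and the term of C just found equals the summand j = 0
   on the right, where 0^0 = 1 and beta_0 = 1. *)
rewrite subnn muln0 big1 ?addr0 => [|j _]; last by rewrite coef_poly /= mulr0.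
have N0 : (0 < N)%N by rewrite /N; lia.
rewrite (bigD1 (Ordinal N0)) //= big1 ?addr0 => [|j]; first by rewrite bern0 !mulr1.
by rewrite -val_eqE /= => /negPf j0; rewrite expr0n j0 mul0r mulr0.
Qed.

(** * From Bernoulli numbers to zeta values *)

(* Euler's formula, with - 24 zeta(2) in place of (2 pi i)^2. *)
Lemma zeta_even (R : realType) k :
  zeta R (2 * k) = - ((- 24 * zeta R 2) ^+ k * ratr (bern (2 * k)) / 2).
Proof.
elim/ltn_ind: k => -[|[|q]] IH.
(* The value zeta(0) = -1/2 makes k = 0 fit; for k = 1 the constant 24 is 2 / beta_2, as beta_2 =
   1/12. *)
- by rewrite muln0 bern0 rmorph1 expr0 /zeta eqxx; field.
- by rewrite muln1 bern2 fmorphV rmorph_nat expr1; field.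
set d := - 24 * zeta R 2 in IH *.
have nz : q.+2%:R + 2^-1 != 0 :> R.
  by rewrite gt_eqF // ltr_wpDl // invr_gt0.
apply: (mulfI nz); rewrite -zeta_conv.
transitivity (d ^+ q.+2 / 4 *
    \sum_(j < q.+1) ratr (bern (2 * j.+1) * bern (2 * (q.+1 - j))) : R).
  rewrite mulr_sumr; apply: eq_bigr => j _; have jq := ltn_ord j.
  rewrite !IH; [|lia..].
  have -> : (q.+2 = j.+1 + (q.+1 - j))%N by lia.
  by rewrite exprD [in RHS]rmorphM /=; field.
rewrite -rmorph_sum /= bern_conv [in LHS]rmorphM rmorphN rmorph_nat /=.
have -> : (2 * q.+2).+1%:R = 2 * (q.+2%:R + 2^-1) :> R.
  by rewrite -natr1 natrM; field.
by field.
Qed.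

(** Read off from [zeta_even], as zeta(2k) is positive for k >= 1 and -1/2 for k = 0; this justifies
    dividing by B_{2l}. *)
Lemma bern_even_neq0 (R : realType) k : ratr (bern (2 * k)) != 0 :> R.
Proof.
have : zeta R (2 * k) != 0.
  case: k => [|k]; first by rewrite muln0 /zeta eqxx oppr_eq0 invr_eq0 pnatr_eq0.
  by rewrite gt_eqF // zeta_gt0; lia.
by apply: contraNneq => b0; rewrite zeta_even b0 mulr0 mul0r oppr0.
Qed.

(** The factor (2l)! / B_{2l} cancels beta_{2l}, and the powers of -24 zeta(2) combine into one
    independent of l. *)
Lemma zeta_even_pair (R : realType) k l : (l <= k)%N ->
  ratr ((2 * l)`!%:R / bernoulli_num (2 * l)) * zeta R (2 * l)
    * zeta R (2 * k - 2 * l)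
  = (- 24 * zeta R 2) ^+ k * ratr (bern (2 * (k - l))) / 4.
Proof.
move=> lk; have -> : (2 * l)`!%:R / bernoulli_num (2 * l) = (bern (2 * l))^-1.
  by rewrite /bern invf_div.
rewrite -mulnBr !zeta_even fmorphV; set d := - 24 * zeta R 2.
have -> : d ^+ k = d ^+ l * d ^+ (k - l) by rewrite -exprD subnKC.
have b0 := bern_even_neq0 R l.
by field; exact: b0.
Qed.

Lemma sum_nat_widen0 (V : nmodType) (f : nat -> V) a b : (a <= b)%N ->
  (forall i, (a <= i < b)%N -> f i = 0) ->
  \sum_(0 <= i < a) f i = \sum_(i < b) f i.
Proof.
move=> ab f0; rewrite -(big_mkord predT) (@big_cat_nat _ _ _ a 0 b) //=.
by rewrite [X in _ + X]big_nat [X in _ + X]big1 ?addr0.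
Qed.

Theorem theorem3p1 (R : realType) (n k : nat) (m : 'I_n -> nat)
    (hn : (0 < n)%N) (hk : (n <= k)%N) :
  let M := (\sum_(j < n) m j)%N in
  let T := maxn ((M + n - 2) %/ 2) ((n - 1) %/ 2) in
  \sum_(c : {ffun 'I_n -> 'I_k.+1} |
          (\sum_(j < n) c j == k)%N && [forall j, (1 <= c j)%N])
     (\prod_(j < n) (c j)%:R ^+ m j) * (\prod_(j < n) zeta R (2 * c j))
  = (-1) ^+ n *
    \sum_(0 <= l < (minn T k).+1)
       (ratr ((2 * l)`!%:R / bernoulli_num (2 * l)) : R)
       * (\sum_(1 <= j < (M + n - 2 * l).+1)
            (ratr (a_ m j l) : R) / 2 ^ ((M + n)%:Z - j%:Z - 1)
            * (k - l)%:R ^+ (j - 1))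
       * zeta R (2 * l) * zeta R (2 * k - 2 * l).
Proof.
move=> M T; set d := - 24 * zeta R 2.
(* Each zeta(2 c_j) is - d^(c_j) beta_{2 c_j} / 2 and each c_j^(m_j) is (2 c_j)^(m_j) / 2^(m_j),
   whence the common factor. *)
transitivity ((-1) ^+ n * (d ^+ k / 2 ^+ (M + n)) *
    ratr (\sum_(c : {ffun 'I_n -> 'I_k.+1} |
          (\sum_(j < n) c j == k)%N && [forall j, (1 <= c j)%N])
     \prod_(j < n) ((2 * c j)%:R ^+ m j * bern (2 * c j))) : R).
  rewrite rmorph_sum mulr_sumr; apply: eq_bigr => c /andP[/eqP ck _].
  rewrite -big_split /= rmorph_prod /=.
  under eq_bigr do rewrite zeta_even -/d.
  have -> : (-1) ^+ n * (d ^+ k / 2 ^+ (M + n)) =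
      \prod_(j < n) (- (d ^+ c j / 2 ^+ (m j).+1)).
    rewrite prodrN card_ord big_split /= prodrXr ck; congr (_ * (_ * _)).
    rewrite prodfV prodrXr; congr (_ ^+ _)^-1.
    by under [RHS]eq_bigr do rewrite -addn1; rewrite big_split /= sum1_card card_ord.
  rewrite -big_split; apply: eq_bigr => j _ /=.
  rewrite [in RHS]rmorphM rmorphXn rmorph_nat natrM (exprMn (m j) 2) exprS /=.
  have := expf_neq0 (m j) (_ : 2 != 0 :> R); rewrite pnatr_eq0 => /(_ isT).
  by move=> ?; field.
rewrite sum_prod_bern // -/M -mulrA; congr (_ * _).
rewrite rmorph_sum mulr_sumr.
pose t l j : R := d ^+ k / 2 ^+ (M + n) *
  ratr (a_ m j.+1 l * ((2 * (k - l))%:R ^+ j * bern (2 * (k - l)))).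
transitivity (\sum_(l < k.+1) \sum_(j < M + n) t l j).
  by apply: eq_bigr => l _; rewrite rmorph_sum mulr_sumr.
(* This cuts the full ranges l <= k and j < M + n of [sum_prod_bern] down to those of the
   theorem. *)
have t0 l j : (j < M + n)%N -> (T < l)%N || (M + n - 2 * l <= j)%N -> t l j = 0.
  by move=> jN H; rewrite /t a_eq0 // mul0r rmorph0 mulr0.
rewrite -(@sum_nat_widen0 _ (fun l => \sum_(j < M + n) t l j) (minn T k).+1).
- rewrite big_nat [RHS]big_nat; apply: eq_bigr => l lT.
  have lk : (l <= k)%N by lia.
  rewrite -(@sum_nat_widen0 _ (t l) (M + n - 2 * l)) ?leq_subr //; last first.
    by move=> j /andP[j1 j2]; rewrite t0 // j1 orbT.
  rewrite [X in _ = _ * X * _ * _]big_add1 /=.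
  rewrite [X in _ = X * _](_ : _ = \sum_(0 <= j < M + n - 2 * l)
      (ratr (a_ m j.+1 l) : R) / 2 ^ ((M + n)%:Z - j.+1%:Z - 1)
            * (k - l)%:R ^+ (j.+1 - 1)
     * (ratr ((2 * l)`!%:R / bernoulli_num (2 * l)) * zeta R (2 * l))); last first.
    by rewrite -mulr_suml; ring.
  rewrite mulr_suml; apply: eq_big_nat => j /andP[_ jN].
  rewrite -[RHS]mulrA zeta_even_pair // -/d /t subn1 /=.
  (* The exponent is -1 when j = M + n - 1, hence the integer power; 2^j comes from (2 (k - l))^j
     and 4 from [zeta_even_pair]. *)
  have -> : (2 : R) ^ ((M + n)%:Z - j.+1%:Z - 1) = 2 ^+ (M + n) / (2 ^+ j * 4).
    have two0 : 2 != 0 :> R by rewrite pnatr_eq0.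
    have -> : (M + n)%:Z - j.+1%:Z - 1 = (M + n)%:Z - (j + 2)%:Z by lia.
    by rewrite expfzDr // -exprnP -exprnN (exprD _ j) -(natrX _ 2 2).
  rewrite [in LHS]rmorphM (rmorphM _ (_ ^+ _)) rmorphXn rmorph_nat natrM (exprMn j 2) /=.
  have := expf_neq0 (M + n) (_ : 2 != 0 :> R); rewrite pnatr_eq0 => /(_ isT) ?.
  have := expf_neq0 j (_ : 2 != 0 :> R); rewrite pnatr_eq0 => /(_ isT) ?.
  by field; apply/andP.
- by rewrite ltnS geq_minr.
move=> l lT; rewrite big1 // => j _; apply: t0 => //; apply/orP; left; lia.
Qed.
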